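(* Let $\mathbb{K}$ be an algebraically closed field, let $X$ be a projective variety over $\mathbb{K}$, let $\mathcal{L}$ be a very ample line bundle on $X$, and regard $X$ as embedded in $\mathbb{P}(H^0(X,\mathcal{L})^* )$ by the complete linear system of $\mathcal{L}$. Let $\mathcal{E}$ be a locally free sheaf on $X$ of rank $e \geq 1$, and let $j=j^{\mathcal{E}} \colon H^0(X,\mathcal{L})^* \to H^0(X,\mathcal{E})^*\otimes H^0(X,\mathcal{L}\otimes\mathcal{E}^\vee)^*$ be the associated linear map. Then for every $F \in H^0(X,\mathcal{L})^*$, $$\operatorname{cr}(F) \;\geq\; \frac{\operatorname{rank} j(F)}{e},$$ where $\operatorname{cr}(F)$ is the cactus rank of $F$ with respect to $X$. In other words, if we fix bases of $H^0(X,\mathcal{E})$ and $H^0(X,\mathcal{L}\otimes\mathcal{E}^\vee)^*$ and so view $j$ as a matrix with entries in $H^0(X,\mathcal{L})$, then for any integer $r\geq 0$ the $(re+1)\times(re+1)$ minors of $j$ give equations for the cactus variety $\kappa_r(X)$, i.e. they vanish on $\kappa_r(X)$.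
   Context: $^*$ denotes the dual vector space and $\mathcal{E}^\vee$ the dual sheaf. The map $j^{\mathcal{E}}$: the canonical morphism $\mathcal{E}\otimes\mathcal{L}\otimes\mathcal{E}^\vee\to\mathcal{L}$ (evaluation of $\mathcal{E}^\vee$ on $\mathcal{E}$) induces a linear map $m\colon H^0(X,\mathcal{E})\otimes H^0(X,\mathcal{L}\otimes\mathcal{E}^\vee)\to H^0(X,\mathcal{L})$. By rearranging factors one obtains $j^{\mathcal{E}}\colon H^0(X,\mathcal{L})^*\to H^0(X,\mathcal{E})^*\otimes H^0(X,\mathcal{L}\otimes\mathcal{E}^\vee)^*$; explicitly, $j^{\mathcal{E}}(F)$ is the bilinear form $(s,t)\mapsto F(m(s\otimes t))$, and $\operatorname{rank} j(F)$ is its rank as a tensor in a tensor product of two vector spaces, i.e. the rank of the linear map $H^0(X,\mathcal{E})\to H^0(X,\mathcal{L}\otimes\mathcal{E}^\vee)^*$, $s\mapsto (t\mapsto F(m(s\otimes t)))$. In chosen bases, the entries of the matrix of this map depend linearly on $F$, so they are elements of $H^0(X,\mathcal{L})$. For a closed subscheme $R\hookrightarrow X$, $\langle R\rangle\subseteq\mathbb{P}(H^0(X,\mathcal{L})^* )$ denotes its linear span, i.e. the smallest projective linear subspace containing $R$ as a subscheme. For a zero-dimensional scheme $R$, $\operatorname{length} R=h^0(R,\mathcal{O}_R)$. For non-zero $F$, with class $[F]$ in the projective space, the cactus rank is $$\operatorname{cr}(F)=\min\{r\in\mathbb{Z}_{\geq 0} : [F]\in\langle R\rangle \text{ for some zero-dimensional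 closed subscheme } R\hookrightarrow X \text{ with } \operatorname{length} R\leq r\},$$ and $\operatorname{cr}(0)=0$ by convention. The $r$-th cactus variety is the Zariski closure $$\kappa_r(X)=\overline{\{[F]\in\mathbb{P}(H^0(X,\mathcal{L})^* ) : \operatorname{cr}(F)\leq r\}}.$$ *)

(* Defs.v *)
(* The notations of multinomials clash with those of MathComp-Analysis and are
   therefore not imported. *)
From HB Require Import structures.
From mathcomp Require Import all_boot all_order all_algebra.
From mathcomp Require Import mathcomp_extra boolp classical_sets functions.
From mathcomp Require Import constructive_ereal topology_structure.
From mathcomp Require Import -(notations) mpoly.

Set Implicit Arguments.
Unset Strict Implicit.
Unset Printing Implicit Defensive.

Import Order.TTheory GRing.Theory Num.Theory.

Local Open Scope classical_set_scope.
Local Open Scope ring_scope.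

(* The minimum of the empty set is +oo. *)
Definition emin (P : set nat) : \bar rat :=
  if pselect (exists n, `[< P n >]) is left h then ((ex_minn h)%:R)%:E else +oo%E.

Section Dimension.
Variables (K : fieldType) (V : lmodType K).

(* [S] is meant to be a linear subspace of [V]. *)
Definition basis_of (S : set V) (n : nat) (b : 'I_n -> V) : Prop :=
  (forall i, S (b i)) /\
  (forall v, S v -> exists! c : 'I_n -> K, v = \sum_(i < n) c i *: b i).

Definition is_basis (n : nat) (b : 'I_n -> V) : Prop := basis_of [set: V] b.

(* At most one [n] qualifies, so this is the dimension, +oo if infinite. *)
Definition vdim (S : set V) : \bar rat :=
  emin [set n | exists b : 'I_n -> V, basis_of S b].

Definition subspace (W : set V) : Prop :=
  W 0 /\ forall (a : K) u v, W u -> W v -> W (a *: u + v).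

End Dimension.


Definition dual (K : fieldType) (V : lmodType K) : Type := {scalar V}.

Section Dual.
Variables (K : fieldType) (V : lmodType K).

Lemma dual_ext (f g : {scalar V}) : f =1 g -> f = g.
Proof.
move: f g => [f cf] [g cg] /= /funext fg; subst g.
by congr GRing.Linear.Pack; move: cf cg => [[a] [b]] [[c] [d]];
   congr GRing.Linear.Class; f_equal; exact: Prop_irrelevance.
Qed.

Definition mk_dual (f : V -> K) (fP : scalar f) : dual V :=
  HB.pack_for {scalar V} f (GRing.isLinear.Build K V K *%R f fP).

Definition dapp (F : dual V) : V -> K := (F : {scalar V}).
Coercion dapp : dual >-> Funclass.

HB.instance Definition _ := gen_eqMixin (dual V).
HB.instance Definition _ := gen_choiceMixin (dual V).

Implicit Types F G : dual V.

Let zero_scalar : scalar (fun _ : V => 0 : K).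
Proof. by move=> a u v; rewrite mulr0 addr0. Qed.
Let add_scalar F G : scalar (fun v => F v + G v).
Proof. by move=> a u v; rewrite /dapp !linearP mulrDr addrACA. Qed.
Let opp_scalar F : scalar (fun v => - F v).
Proof. by move=> a u v; rewrite /dapp linearP opprD mulrN. Qed.
Let scale_scalar (c : K) F : scalar (fun v => c * F v).
Proof. by move=> a u v; rewrite /dapp linearP mulrDr mulrCA. Qed.

Definition dual0 : dual V := mk_dual zero_scalar.
Definition dual_add F G : dual V := mk_dual (@add_scalar F G).
Definition dual_opp F : dual V := mk_dual (@opp_scalar F).
Definition dual_scale c F : dual V := mk_dual (@scale_scalar c F).

Let addA : associative dual_add.
Proof. by move=> f g h; apply: dual_ext => x /=; rewrite addrA. Qed.
Let addC : commutative dual_add.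
Proof. by move=> f g; apply: dual_ext => x /=; rewrite addrC. Qed.
Let add0 : left_id dual0 dual_add.
Proof. by move=> f; apply: dual_ext => x /=; rewrite add0r. Qed.
Let addN : left_inverse dual0 dual_opp dual_add.
Proof. by move=> f; apply: dual_ext => x /=; rewrite addNr. Qed.

HB.instance Definition _ := GRing.isZmodule.Build (dual V) addA addC add0 addN.

Let scaleA a b F : dual_scale a (dual_scale b F) = dual_scale (a * b) F.
Proof. by apply: dual_ext => x /=; rewrite /dapp /= mulrA. Qed.
Let scale1 : left_id 1 dual_scale.
Proof. by move=> f; apply: dual_ext => x /=; rewrite mul1r. Qed.
Let scaleDr : right_distributive dual_scale +%R.
Proof. by move=> a f g; apply: dual_ext => x /=; rewrite /dapp /= mulrDr. Qed.
Let scaleDl F : {morph dual_scale^~ F : a b / a + b}.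
Proof. by move=> a b; apply: dual_ext => x /=; rewrite /dapp /= mulrDl. Qed.

HB.instance Definition _ := GRing.Zmodule_isLmodule.Build K (dual V)
  scaleA scale1 scaleDr scaleDl.

Lemma dualD F G v : (F + G) v = F v + G v. Proof. by []. Qed.
Lemma dualZ c F v : (c *: F) v = c * F v. Proof. by []. Qed.

End Dual.

Record opens (T : topologicalType) := Opens { oset :> set T; _ : open oset }.
Arguments Opens {T}.

Section Opens.
Variable T : topologicalType.

Lemma openP (U : opens T) : open U. Proof. by case: U. Qed.

Definition oT : opens T := Opens setT openT.

Definition ocap (U V : opens T) : opens T := Opens _ (openI (openP U) (openP V)).

Lemma sub_oT (U : opens T) : U `<=` oT. Proof. by []. Qed.

(* [F] with the restriction maps [res] is a presheaf; the condition is that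
   compatible families glue uniquely (the empty family included). *)
Definition is_sheaf (F : opens T -> Type)
    (res : forall U V : opens T, V `<=` U -> F U -> F V) : Prop :=
  forall (I : Type) (U : opens T) (W : I -> opens T) (hW : forall i, W i `<=` U),
  U `<=` \bigcup_i W i ->
  forall s : (forall i, F (W i)),
  (forall i j (V : opens T) (hi : V `<=` W i) (hj : V `<=` W j),
     res _ _ hi (s i) = res _ _ hj (s j)) ->
  exists! t : F U, forall i, res _ _ (hW i) t = s i.

End Opens.
Arguments oT {T}.
Arguments sub_oT {T} U.

(* The ring morphism [kstr] is the structure morphism to [Spec K]. *)
Record kspace (K : fieldType) := KSpace {
  carrier :> topologicalType;
  osec : opens carrier -> comPzRingType;
  ores : forall U V : opens carrier, V `<=` U -> {rmorphism osec U -> osec V};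
  ores_id : forall (U : opens carrier) (h : U `<=` U) f, ores h f = f;
  ores_comp : forall (U V W : opens carrier) (h : V `<=` U) (h' : W `<=` V)
    (h'' : W `<=` U) f, ores h' (ores h f) = ores h'' f;
  osheaf : is_sheaf (fun U V (h : V `<=` U) => ores h : osec U -> osec V);
  kstr : {rmorphism K -> osec oT}
}.
Arguments osec {K X} U : rename.
Arguments ores {K X U V} h : rename.
Arguments kstr {K} X : rename.

Record omod (K : fieldType) (X : kspace K) := OMod {
  msec : forall U : opens X, lmodType (osec U);
  mres : forall U V : opens X, V `<=` U -> msec U -> msec V;
  mresP : forall (U V : opens X) (h : V `<=` U) (a : osec U) (s t : msec U),
    mres h (a *: s + t) = ores h a *: mres h s + mres h t;
  mres_id : forall (U : opens X) (h : U `<=` U) s, mres h s = s;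
  mres_comp : forall (U V W : opens X) (h : V `<=` U) (h' : W `<=` V)
    (h'' : W `<=` U) s, mres h' (mres h s) = mres h'' s;
  msheaf : is_sheaf (fun U V (h : V `<=` U) => mres h : msec U -> msec V)
}.
Arguments msec {K X} M U : rename.
Arguments mres {K X M U V} h s : rename.

Section Modules.
Variables (K : fieldType) (X : kspace K).
Implicit Types M N E L : omod X.

Section MresTheory.
Variables (M : omod X) (U V : opens X) (h : V `<=` U).
Lemma mresD (s t : msec M U) : mres h (s + t) = mres h s + mres h t.
Proof. by rewrite -[s in LHS]scale1r mresP rmorph1 scale1r. Qed.
Lemma mres0 : mres h (0 : msec M U) = 0.
Proof. by apply: (addrI (mres h 0)); rewrite -mresD !addr0. Qed.
Lemma mresZ (a : osec U) (s : msec M U) : mres h (a *: s) = ores h a *: mres h s.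
Proof. by rewrite -[a *: s]addr0 mresP mres0 addr0. Qed.
End MresTheory.

Definition gsec M : Type := msec M oT.

HB.instance Definition _ M := GRing.Zmodule.on (gsec M).

Section GlobalSections.
Variable M : omod X.
Definition gscale (c : K) (s : gsec M) : gsec M := kstr X c *: (s : msec M oT).
Let scaleA a b s : gscale a (gscale b s) = gscale (a * b) s.
Proof. by rewrite /gscale scalerA rmorphM. Qed.
Let scale1 : left_id 1 gscale.
Proof. by move=> s; rewrite /gscale rmorph1 scale1r. Qed.
Let scaleDr : right_distributive gscale +%R.
Proof. by move=> a s t; rewrite /gscale scalerDr. Qed.
Let scaleDl s : {morph gscale^~ s : a b / a + b}.
Proof. by move=> a b; rewrite /gscale rmorphD scalerDl. Qed.
HB.instance Definition _ := GRing.Zmodule_isLmodule.Build K (gsec M)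
  scaleA scale1 scaleDr scaleDl.
End GlobalSections.

Definition omod_struct : omod X.
Proof.
refine (@OMod K X (fun U => (osec U)^o) (fun U V h => ores h) _ _ _ _).
- by move=> U V h a s t; rewrite rmorphD rmorphM.
- exact: ores_id.
- exact: ores_comp.
- exact: osheaf.
Defined.

(* [b] induces an isomorphism from the free module of rank [n] on [U] to the
   restriction of [M] to [U]. *)
Definition is_frame M (U : opens X) (n : nat) (b : 'I_n -> msec M U) : Prop :=
  forall (V : opens X) (h : V `<=` U) (s : msec M V),
  exists! c : 'I_n -> osec V, s = \sum_(i < n) c i *: mres h (b i).

Definition locally_free (n : nat) M : Prop :=
  forall x : X, exists (U : opens X) (b : 'I_n -> msec M U),
    oset U x /\ is_frame b.

Definition line_bundle L : Prop := locally_free 1 L.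

(* For a line bundle, the section [s] does not vanish at the point [x]. *)
Definition generates_at L (s : gsec L) (x : X) : Prop :=
  exists U : opens X, oset U x /\
    is_frame (fun _ : 'I_1 => mres (sub_oT U) (s : msec L oT)).

(* Morphisms of modules from the restriction of [M] to [U] to that of [N]. *)
Record hom_on M N (U : opens X) := HomOn {
  hfun :> forall V : opens X, V `<=` U -> msec M V -> msec N V;
  hfunP : forall (V : opens X) (h : V `<=` U) (a : osec V) (s t : msec M V),
    hfun h (a *: s + t) = a *: hfun h s + hfun h t;
  hfun_res : forall (V W : opens X) (h : V `<=` U) (h' : W `<=` V)
    (h'' : W `<=` U) (s : msec M V),
    mres h' (hfun h s) = hfun h'' (mres h' s)
}.

Lemma hom_ext M N (U : opens X) (f g : hom_on M N U) :
  (forall (V : opens X) (h : V `<=` U) s, f V h s = g V h s) -> f = g.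
Proof.
move: f g => [f f1 f2] [g g1 g2] /= fg.
have e : f = g.
  by apply: functional_extensionality_dep => V;
     apply: functional_extensionality_dep => h; apply: funext => s; exact: fg.
by subst g; congr HomOn; exact: Prop_irrelevance.
Qed.

Section HomSheaf.
Variables M N : omod X.

Section HomModule.
Variable U : opens X.
Implicit Types f g : hom_on M N U.

HB.instance Definition _ := gen_eqMixin (hom_on M N U).
HB.instance Definition _ := gen_choiceMixin (hom_on M N U).

Definition hom0 : hom_on M N U.
Proof.
exists (fun V h s => 0); first by move=> *; rewrite scaler0 addr0.
by move=> *; rewrite mres0.
Defined.
Definition hom_add f g : hom_on M N U.
Proof.
exists (fun V h s => f V h s + g V h s).
  by move=> V h a s t; rewrite !hfunP scalerDr addrACA.
by move=> V W h h' h'' s; rewrite mresD !(hfun_res _ h h' h'').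
Defined.
Definition hom_scale (a : osec U) f : hom_on M N U.
Proof.
exists (fun V h s => ores h a *: f V h s).
  by move=> V h b s t; rewrite !hfunP scalerDr !scalerA mulrC.
by move=> V W h h' h'' s; rewrite mresZ (hfun_res _ h h' h'') (ores_comp h h' h'').
Defined.
Definition hom_opp f : hom_on M N U := hom_scale (-1) f.

Let addA : associative hom_add.
Proof. by move=> f g k; apply: hom_ext => V h s /=; rewrite addrA. Qed.
Let addC : commutative hom_add.
Proof. by move=> f g; apply: hom_ext => V h s /=; rewrite addrC. Qed.
Let add0 : left_id hom0 hom_add.
Proof. by move=> f; apply: hom_ext => V h s /=; rewrite add0r. Qed.
Let addN : left_inverse hom0 hom_opp hom_add.
Proof.
by move=> f; apply: hom_ext => V h s /=; rewrite rmorphN1 scaleN1r addNr.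
Qed.
HB.instance Definition _ :=
  GRing.isZmodule.Build (hom_on M N U) addA addC add0 addN.

Let scaleA a b f : hom_scale a (hom_scale b f) = hom_scale (a * b) f.
Proof. by apply: hom_ext => V h s /=; rewrite scalerA rmorphM. Qed.
Let scale1 : left_id 1 hom_scale.
Proof. by move=> f; apply: hom_ext => V h s /=; rewrite rmorph1 scale1r. Qed.
Let scaleDr : right_distributive hom_scale +%R.
Proof. by move=> a f g; apply: hom_ext => V h s /=; rewrite scalerDr. Qed.
Let scaleDl f : {morph hom_scale^~ f : a b / a + b}.
Proof. by move=> a b; apply: hom_ext => V h s /=; rewrite rmorphD scalerDl. Qed.
HB.instance Definition _ := GRing.Zmodule_isLmodule.Build (osec U)
  (hom_on M N U) scaleA scale1 scaleDr scaleDl.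
End HomModule.

Definition hom_res (U V : opens X) (h : V `<=` U) (f : hom_on M N U) :
  hom_on M N V.
Proof.
exists (fun W k s => f W (subset_trans k h) s).
  by move=> W k a s t; rewrite hfunP.
by move=> W Z k k' k'' s; apply: hfun_res.
Defined.

Lemma hom_app_eq (V : opens X) (f : hom_on M N V) (W : opens X)
  (h h' : W `<=` V) s s' : s = s' -> f W h s = f W h' s'.
Proof. by move=> ->; congr (f _ _ _); exact: Prop_irrelevance. Qed.

Lemma hom_sheaf : is_sheaf (fun U V (h : V `<=` U) => hom_res h).
Proof.
move=> I U W hW cov f fcomp.
have capl (V : opens X) i : ocap V (W i) `<=` V by move=> x [].
have capr (V : opens X) i : ocap V (W i) `<=` W i by move=> x [].
have covV (V : opens X) : V `<=` U -> V `<=` \bigcup_i ocap V (W i).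
  by move=> h x Vx; have [i _ Wx] := cov x (h x Vx); exists i.
have fE i j (Z : opens X) (hi : Z `<=` W i) (hj : Z `<=` W j) (m : msec M Z) :
    f i Z hi m = f j Z hj m.
  have /(congr1 (fun g : hom_on M N Z => g Z (@subset_refl _ Z) m)) :=
    fcomp i j Z hi hj.
  by move=> /= e; apply: etrans (etrans e _); exact: hom_app_eq.
have glue (V : opens X) (h : V `<=` U) (m : msec M V) :
    exists! n : msec N V, forall i,
      mres (capl V i) n = f i _ (capr V i) (mres (capl V i) m).
  apply: (@msheaf K X N I V (fun i => ocap V (W i)) (capl V) (covV V h)
    (fun i => f i _ (capr V i) (mres (capl V i) m))) => i j Z hi hj.
  rewrite !(hfun_res _ _ _ (subset_trans hi (capr V i))).
  rewrite !(hfun_res _ _ _ (subset_trans hj (capr V j))).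
  rewrite !(mres_comp _ _ (subset_trans hi (capl V i))).
  by rewrite (fE i j _ _ (subset_trans hj (capr V j))).
pose g V h m := sval (cid (glue V h m)).
have gP V h m i : mres (capl V i) (g V h m) = f i _ (capr V i) (mres (capl V i) m).
  by rewrite /g; case: cid => n [].
have gU V h m n : (forall i,
    mres (capl V i) n = f i _ (capr V i) (mres (capl V i) m)) -> g V h m = n.
  by rewrite /g; case: cid => n' [? nU] /nU.
have glin : forall V h (a : osec V) s t,
    g V h (a *: s + t) = a *: g V h s + g V h t.
  move=> V h a s t; apply: gU => i.
  by rewrite mresP !gP -hfunP -mresP.
have gres : forall (V V' : opens X) (h : V `<=` U) (h' : V' `<=` V)
    (h'' : V' `<=` U) s, mres h' (g V h s) = g V' h'' (mres h' s).
  move=> V V' h h' h'' s; apply/esym/gU => i.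
  have k : ocap V' (W i) `<=` ocap V (W i) by move=> x [/h' ? ?].
  rewrite !(mres_comp _ _ (subset_trans k (capl V i))).
  rewrite -!(mres_comp (capl V i) k) gP.
  by rewrite (hfun_res _ _ _ (capr V' i)).
exists (HomOn glin gres); split=> [i|f' f'P].
  apply: hom_ext => V h m /=; apply: gU => j.
  by rewrite (hfun_res _ _ _ (subset_trans (capl V j) h)); exact: fE.
apply: hom_ext => V h m /=; apply: gU => i.
rewrite (hfun_res _ _ _ (subset_trans (capl V i) h)).
have /(congr1 (fun q : hom_on M N (W i) => q _ (capr V i) (mres (capl V i) m))) :=
  f'P i.
by move=> /= <-; exact: hom_app_eq.
Qed.

Definition omod_hom : omod X.
Proof.
refine (@OMod K X (fun U => hom_on M N U) hom_res _ _ _ hom_sheaf).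
- move=> U V h a s t; apply: hom_ext => W k m /=.
  by rewrite (ores_comp h k (subset_trans k h)).
- by move=> U h s; apply: hom_ext => W k m; exact: (hom_app_eq s).
- by move=> U V W h h' h'' s; apply: hom_ext => Z k m; exact: (hom_app_eq s).
Defined.

End HomSheaf.

Definition omod_dual E : omod X := omod_hom E omod_struct.

Record bilin L M N := Bilin {
  bfun :> forall U : opens X, msec L U -> msec M U -> msec N U;
  bfunPl : forall (U : opens X) (a : osec U) l l' m,
    bfun (a *: l + l') m = a *: bfun l m + bfun l' m;
  bfunPr : forall (U : opens X) (a : osec U) l m m',
    bfun l (a *: m + m') = a *: bfun l m + bfun l m';
  bfun_res : forall (U V : opens X) (h : V `<=` U) l m,
    mres h (bfun l m) = bfun (mres h l) (mres h m)
}.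

(* The tensor product of sheaves of modules, through its universal property,
   which determines it up to a unique isomorphism. *)
Record tensor L M := Tensor {
  tobj :> omod X;
  tmul : bilin L M tobj;
  tuniv : forall (N : omod X) (b : bilin L M N),
    exists! h : hom_on tobj N oT, forall (U : opens X) l m,
      h U (sub_oT U) (tmul U l m) = b U l m
}.

Section Evaluation.
Variables L E : omod X.

(* A section [l] of [L] and a section [phi] of the dual of [E] give the
   morphism [s |-> phi(s) l] from [E] to [L]. *)
Definition contract_fun (U : opens X) (l : msec L U)
  (phi : msec (omod_dual E) U) : msec (omod_hom E L) U.
Proof.
exists (fun V h s => ((phi : hom_on E omod_struct U) V h s : osec V)
                       *: mres h l).
  by move=> V h a s t; rewrite hfunP scalerDl scalerA.
move=> V W h h' h'' s; rewrite mresZ (mres_comp h h' h'').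
by congr (_ *: _); exact: (hfun_res phi h h' h'' s).
Defined.

Definition contract : bilin L (omod_dual E) (omod_hom E L).
Proof.
exists contract_fun.
- move=> U a l l' phi; apply: hom_ext => V h s /=.
  by rewrite mresP scalerDr !scalerA mulrC.
- by move=> U a l phi phi'; apply: hom_ext => V h s /=; rewrite scalerDl scalerA.
- move=> U V h l phi; apply: hom_ext => W k s /=.
  by rewrite (mres_comp h k (subset_trans k h)).
Defined.

Variable T : tensor L (omod_dual E).

(* The canonical morphism from the tensor product of [L] with the dual of [E]
   to the sheaf of morphisms from [E] to [L]; it is the evaluation morphism
   of [E (x) L (x) E^v] to [L], curried. *)
Definition ev : hom_on T (omod_hom E L) oT := sval (cid (tuniv T contract)).

(* The multiplication map [m] on global sections. *)
Definition mulmap (s : gsec E) (t : gsec T) : gsec L :=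
  (ev oT (sub_oT oT) t : hom_on E L oT) oT (sub_oT oT) s.

Lemma mulmapE s (l : gsec L) (phi : gsec (omod_dual E)) :
  mulmap s (tmul T oT l phi) =
  ((phi : hom_on E omod_struct oT) oT (sub_oT oT) s : osec oT) *: (l : msec L oT).
Proof.
rewrite /mulmap /ev; case: cid => h [hE _] /=.
by rewrite hE /= mres_id.
Qed.

Lemma mulmapDl c s s' t :
  mulmap (c *: s + s') t = c *: mulmap s t + mulmap s' t.
Proof. by rewrite /mulmap hfunP. Qed.

Lemma mulmapDr c s t t' :
  mulmap s (c *: t + t') = c *: mulmap s t + mulmap s t'.
Proof.
by rewrite /mulmap hfunP /= ores_id.
Qed.

Let jmap_scalar (F : dual (gsec L)) s : scalar (fun t => F (mulmap s t)).
Proof. by move=> c t t'; rewrite mulmapDr /dapp linearP. Qed.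

(* [j(F)], as a map from the sections of [E] to the dual of those of [T]. *)
Definition jmap (F : dual (gsec L)) (s : gsec E) : dual (gsec T) :=
  mk_dual (@jmap_scalar F s).

Definition jrank (F : dual (gsec L)) : \bar rat := vdim (range (jmap F)).

End Evaluation.

End Modules.

Section Schemes.
Variables (K : fieldType) (X : kspace K).

(* The germ of [f] at [x] is a unit of the stalk. *)
Definition unit_at (x : X) (U : opens X) (f : osec U) : Prop :=
  exists (V : opens X) (h : V `<=` U) (g : osec V), oset V x /\ ores h f * g = 1.

(* Every stalk is a local ring: it is nonzero, and nonunits are stable under
   addition. *)
Definition locally_ringed : Prop :=
  forall (x : X) (U : opens X), oset U x ->
    ~ unit_at x (0 : osec U) /\
    (forall f g : osec U, unit_at x (f + g) -> unit_at x f \/ unit_at x g).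

Definition prime_ideal (A : comPzRingType) (P : set A) : Prop :=
  [/\ P 0, (forall f g, P f -> P g -> P (f + g)), (forall f g, P g -> P (f * g)),
      ~ P 1 & (forall f g, P (f * g) -> P f \/ P g)].

Definition nonvanishing (U : opens X) (f : osec U) : set X :=
  [set x | oset U x /\ unit_at x f].

(* [U] is isomorphic to the spectrum of [A := osec U] via the canonical map,
   which sends [x] to the prime ideal of those [f] whose germ at [x] is not a
   unit: this map is a bijection onto the primes of [A], it is a
   homeomorphism (the nonvanishing loci [D f] of elements of [A], which are
   the preimages of the distinguished open sets of the spectrum, form a base
   of the topology of [U]), and the sections on [D f] are the localization of
   [A] at [f]. *)
Definition is_affine (U : opens X) : Prop :=
  [/\ (forall x, oset U x -> prime_ideal [set f : osec U | ~ unit_at x f]),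
      (forall P : set (osec U), prime_ideal P ->
         exists! x, oset U x /\ P = [set f | ~ unit_at x f]),
      (forall (V : opens X) x, V `<=` U -> oset V x ->
         exists f : osec U, nonvanishing f x /\ nonvanishing f `<=` V) &
      (forall (f : osec U) (D : opens X) (h : D `<=` U),
         oset D = nonvanishing f ->
         [/\ (exists g : osec D, ores h f * g = 1),
             (forall g : osec D, exists (n : nat) (a : osec U),
                ores h f ^+ n * g = ores h a) &
             (forall a : osec U, ores h a = 0 -> exists n : nat, f ^+ n * a = 0)])].

Definition is_scheme : Prop :=
  locally_ringed /\ forall x : X, exists U : opens X, oset U x /\ is_affine U.

Definition is_integral : Prop :=
  inhabited X /\
  forall U : opens X, U !=set0 ->
    (1 : osec U) <> 0 /\ (forall f g : osec U, f * g = 0 -> f = 0 \/ g = 0).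

Definition irreducible_closed (Z : set X) : Prop :=
  [/\ closed Z, Z !=set0 &
      forall A B : set X, closed A -> closed B -> Z `<=` A `|` B ->
        Z `<=` A \/ Z `<=` B].

(* Krull dimension zero: there is no chain of two irreducible closed subsets.
   The empty scheme is allowed. *)
Definition zero_dimensional : Prop :=
  forall Z Z' : set X, irreducible_closed Z -> irreducible_closed Z' ->
    Z `<=` Z' -> Z = Z'.

(* [h^0(X, O_X)] *)
Definition scheme_length : \bar rat := vdim [set: gsec (omod_struct X)].

End Schemes.

Section Morphisms.
Variable K : fieldType.

Definition opreim (S T : topologicalType) (f : S -> T) (fc : continuous f)
  (U : opens T) : opens S := Opens (f @^-1` U) ((continuousP f).1 fc U (openP U)).

Record kmor (X Y : kspace K) := KMor {
  mfun :> X -> Y;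
  mcont : continuous mfun;
  msharp : forall U : opens Y, {rmorphism osec U -> osec (opreim mcont U)};
  msharp_res : forall (U V : opens Y) (h : V `<=` U)
    (h' : opreim mcont V `<=` opreim mcont U) f,
    ores h' (msharp U f) = msharp V (ores h f);
  msharp_local : forall (U : opens Y) (f : osec U) (x : X),
    oset U (mfun x) -> unit_at x (msharp U f) -> unit_at (mfun x) f;
  msharp_kstr : forall c : K, msharp oT (kstr Y c) = ores (sub_oT _) (kstr X c)
}.
Arguments mcont {X Y} f : rename.
Arguments msharp {X Y} f U : rename.

(* A homeomorphism onto a closed subset, with a surjective morphism of sheaves
   from [O_Y] to the direct image of [O_X]. *)
Definition closed_immersion (X Y : kspace K) (i : kmor X Y) : Prop :=
  [/\ injective i, closed (range i),
      (forall U : opens X, exists V : opens Y, oset U = i @^-1` V) &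
      (forall (U : opens Y) (g : osec (opreim (mcont i) U)) (y : Y), oset U y ->
         exists (V : opens Y) (h : V `<=` U)
                (h' : opreim (mcont i) V `<=` opreim (mcont i) U) (f : osec V),
           oset V y /\ msharp i V f = ores h' g)].

(* The pullback of [s] along the closed immersion [i] is zero: locally [s] is
   a combination of sections whose coefficients are in the ideal sheaf of
   [i]. *)
Definition vanishes_on (X R : kspace K) (i : kmor R X) (M : omod X)
    (s : gsec M) : Prop :=
  forall x : X, exists (U : opens X) (n : nat) (f : 'I_n -> osec U)
    (m : 'I_n -> msec M U),
    [/\ oset U x, (forall k, msharp i U (f k) = 0) &
        mres (sub_oT U) (s : msec M oT) = \sum_(k < n) f k *: m k].

End Morphisms.
Arguments mcont {K X Y} f : rename.
Arguments msharp {K X Y} f U : rename.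

Section ProjectiveSpace.
Variables (K : fieldType) (n : nat).
Local Notation S := (mpoly n.+1 K).
Local Notation var i := (mpolyX K (mnm1 i) : S).

(* Homogeneous prime ideals that do not contain the irrelevant ideal. *)
Record proj := Proj {
  pideal : set S;
  _ : pideal 0;
  _ : forall f g, pideal f -> pideal g -> pideal (f + g);
  _ : forall f g, pideal g -> pideal (f * g);
  _ : ~ pideal 1;
  _ : forall f g, pideal (f * g) -> pideal f \/ pideal g;
  _ : forall f d, pideal f -> pideal (pihomog mdeg d f);
  _ : exists i, ~ pideal (var i)
}.

HB.instance Definition _ := gen_eqMixin proj.
HB.instance Definition _ := gen_choiceMixin proj.

(* The closed sets are the sets of primes containing a given set of
   polynomials. *)
Definition proj_open : set (set proj) :=
  [set U | exists A : set S, U = [set p : proj | ~ (A `<=` pideal p)]].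

Let proj_openT : proj_open setT.
Proof.
exists setT; apply/seteqP; split=> // -[p p0 pD pM p1 ? ? ?] _ /= /(_ 1 I).
exact: p1.
Qed.

Let proj_openI : setI_closed proj_open.
Proof.
move=> _ _ [A ->] [B ->].
exists [set h | exists f g, [/\ A f, B g & h = f * g]].
apply/seteqP; split=> -[p p0 pD pM p1 pP ? ?] /=.
  move=> [/existsNP[f /not_implyP[Af pf]] /existsNP[g /not_implyP[Bg pg]]] ABp.
  have := ABp (f * g); rewrite /= => /(_ (ex_intro _ f (ex_intro _ g _))).
  by case/(_ (And3 Af Bg erefl))/pP.
move=> /existsNP[_ /not_implyP[[f [g [Af Bg ->]]] pfg]]; split=> [Ap|Bp].
  by apply: pfg; rewrite mulrC; apply: pM; exact: Ap.
by apply: pfg; apply: pM; exact: Bp.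
Qed.

Let proj_openU (I : Type) (f : I -> set proj) :
  (forall i, proj_open (f i)) -> proj_open (\bigcup_i f i).
Proof.
move=> /choice[A fA]; exists (\bigcup_i A i); apply/seteqP; split=> p /=.
  by move=> [i _]; rewrite fA /= => Ap Up; apply: Ap => h Ah; apply: Up; exists i.
move=> /existsNP[h /not_implyP[[i _ Ah] ph]]; exists i => //.
by rewrite fA /= => /(_ _ Ah).
Qed.

HB.instance Definition _ :=
  isOpenTopological.Build proj proj_openT proj_openI proj_openU.

Lemma proj_openE (U : set proj) : open U = proj_open U.
Proof. by []. Qed.

Local Notation points U := {p : proj | oset U p}.
Local Notation frac := {fraction S}.

(* All homogeneous localizations are subrings of the fraction field of the
   polynomial ring; a section is a function with values in that field that
   locally is a quotient of homogeneous polynomials of the same degree. *)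
Definition regular (U : opens proj) (s : points U -> frac) : Prop :=
  forall p, oset U p -> exists (V : opens proj) (d : nat) (a b : S),
    [/\ oset V p, a \is ishomog1 d mdeg, b \is ishomog1 d mdeg &
        forall (q : points U), oset V (sval q) ->
          ~ pideal (sval q) b /\ s q = tofrac a / tofrac b].

Definition regular_pred (U : opens proj) : {pred points U -> frac} :=
  fun s => `[< regular s >].


Lemma regularP (U : opens proj) (s : points U -> frac) :
  reflect (regular s) (s \in @regular_pred U).
Proof. exact: asboolP. Qed.

Lemma proj_prime (p : proj) f g :
  ~ pideal p f -> ~ pideal p g -> ~ pideal p (f * g).
Proof. by case: p => p ? ? ? ? pP ? ? /= pf pg /pP[]. Qed.

Lemma proj_nz (p : proj) f : ~ pideal p f -> tofrac f != 0 :> frac.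
Proof.
move=> pf; rewrite tofrac_eq0; apply/eqP => f0; apply: pf; rewrite f0.
by case: p.
Qed.

Lemma subf_div (F : fieldType) (x y z t : F) :
  y != 0 -> t != 0 -> x / y - z / t = (x * t - z * y) / (y * t).
Proof. by move=> y0 t0; rewrite -mulNr addf_div // mulNr. Qed.

Lemma regular_subring (U : opens proj) : subring_closed (@regular_pred U).
Proof.
split.
- apply/regularP => p Up; exists U, 0%N, 1, 1; split=> //.
  + exact: dhomog1.
  + exact: dhomog1.
  + by move=> q _; split; [case: (sval q) | rewrite rmorph1 divr1].
- move=> s t /regularP rs /regularP rt; apply/regularP => p Up.
  have [V [d [a [b [Vp ha hb sE]]]]] := rs p Up.
  have [W [e [a' [b' [Wp ha' hb' tE]]]]] := rt p Up.
  exists (ocap V W), (d + e)%N, (a * b' - a' * b), (b * b'); split=> //.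
  + by apply: rpredB; [exact: dhomogM | rewrite addnC; exact: dhomogM].
  + exact: dhomogM.
  + move=> q [/= /sE[qb sq] /tE[qb' tq]]; split; first exact: proj_prime.
    have -> : (s - t) q = s q - t q by [].
    rewrite sq tq rmorphB !rmorphM.
    exact: subf_div (proj_nz qb) (proj_nz qb').
- move=> s t /regularP rs /regularP rt; apply/regularP => p Up.
  have [V [d [a [b [Vp ha hb sE]]]]] := rs p Up.
  have [W [e [a' [b' [Wp ha' hb' tE]]]]] := rt p Up.
  exists (ocap V W), (d + e)%N, (a * a'), (b * b'); split=> //.
  + exact: dhomogM.
  + exact: dhomogM.
  + move=> q [/= /sE[qb sq] /tE[qb' tq]]; split; first exact: proj_prime.
    have -> : (s * t) q = s q * t q by [].
    by rewrite sq tq !rmorphM /= mulf_div.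
Qed.

Record proj_sec (U : opens proj) := ProjSec {
  pval :> points U -> frac;
  _ : pval \in @regular_pred U
}.

HB.instance Definition _ (U : opens proj) := [isSub for @pval U].
HB.instance Definition _ (U : opens proj) := [Choice of proj_sec U by <:].
HB.instance Definition _ (U : opens proj) :=
  GRing.SubChoice_isSubComPzRing.Build (points U -> frac) (@regular_pred U)
    (proj_sec U) (@regular_subring U).

Lemma proj_sec_eq (U : opens proj) (s t : proj_sec U) :
  (forall p, s p = t p) -> s = t.
Proof. by move=> st; apply: val_inj; apply: funext. Qed.

Definition mkpoint (U : opens proj) (p : proj) (Up : oset U p) : points U :=
  exist _ p Up.

Definition point_incl (U V : opens proj) (h : V `<=` U) (p : points V) :
  points U := mkpoint (h _ (svalP p)).

Lemma point_eq (U : opens proj) (p q : points U) : sval p = sval q -> p = q.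
Proof. by move=> pq; apply: eq_sig_hprop => // ?; exact: Prop_irrelevance. Qed.

Lemma regular_res (U V : opens proj) (h : V `<=` U) (s : proj_sec U) :
  (pval s \o point_incl h) \in @regular_pred V.
Proof.
apply/regularP => p Vp; case: s => s /= /regularP /(_ p (h p Vp)).
move=> [W [d [a [b [Wp ha hb sE]]]]]; exists W, d, a, b; split=> // q Wq.
exact: (sE (point_incl h q) Wq).
Qed.

Definition proj_res_fun (U V : opens proj) (h : V `<=` U) (s : proj_sec U) :
  proj_sec V := ProjSec (regular_res h s).

Let proj_res_zmod (U V : opens proj) (h : V `<=` U) :
  zmod_morphism (proj_res_fun h).
Proof. by move=> s t; exact: proj_sec_eq. Qed.
Let proj_res_monoid (U V : opens proj) (h : V `<=` U) :
  monoid_morphism (proj_res_fun h).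
Proof. by split=> [|s t]; exact: proj_sec_eq. Qed.

HB.instance Definition _ (U V : opens proj) (h : V `<=` U) :=
  GRing.isZmodMorphism.Build (proj_sec U) (proj_sec V) (proj_res_fun h)
    (proj_res_zmod h).
HB.instance Definition _ (U V : opens proj) (h : V `<=` U) :=
  GRing.isMonoidMorphism.Build (proj_sec U) (proj_sec V) (proj_res_fun h)
    (proj_res_monoid h).

Definition proj_res (U V : opens proj) (h : V `<=` U) :
  {rmorphism proj_sec U -> proj_sec V} := proj_res_fun h.

Lemma proj_sheaf : is_sheaf (fun U V (h : V `<=` U) =>
  proj_res h : proj_sec U -> proj_sec V).
Proof.
move=> I U W hW cov s scomp.
have sE i j (p : points (W i)) (q : points (W j)) :
    sval p = sval q -> s i p = s j q.
  move=> pq; pose Z := ocap (W i) (W j).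
  have hi : Z `<=` W i by move=> x [].
  have hj : Z `<=` W j by move=> x [].
  have Zp : oset Z (sval p) by split; [|rewrite pq]; exact: svalP.
  have /(congr1 (fun f : proj_sec Z => f (mkpoint Zp))) := scomp i j Z hi hj.
  rewrite /= => e.
  have -> : p = point_incl hi (mkpoint Zp) by exact: point_eq.
  by rewrite [LHS]e; congr (s j _); exact: point_eq.
have pick (p : points U) : {i | oset (W i) (sval p)}.
  by apply: cid; have [i _ ?] := cov _ (svalP p); exists i.
pose t (p : points U) := s (sval (pick p)) (mkpoint (svalP (pick p))).
have tE i (p : points U) (q : points (W i)) : sval p = sval q -> t p = s i q.
  by move=> pq; exact: sE.
have tr : t \in @regular_pred U.
  apply/regularP => p Up; have [i _ Wp] := cov p Up.
  case si : (s i) => [f fr]; move: (fr) => /regularP /(_ p Wp).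
  move=> [V [d [a [b [Vp ha hb fE]]]]].
  exists (ocap V (W i)), d, a, b; split=> // q [Vq Wq].
  have [qb fq] := fE (mkpoint Wq) Vq; split=> //.
  by rewrite (@tE i _ (mkpoint Wq)) // si.
exists (ProjSec tr); split=> [i|t' t'E].
  by apply: proj_sec_eq => q; exact: tE.
apply: proj_sec_eq => p /=; have [i _ Wp] := cov _ (svalP p).
rewrite (@tE i _ (mkpoint Wp)) // -t'E /=.
by congr (t' _); exact: point_eq.
Qed.

Lemma regular_cst (c : K) :
  (fun _ => tofrac (mpolyC n.+1 c)) \in @regular_pred oT.
Proof.
apply/regularP => p _; exists oT, 0%N, (mpolyC n.+1 c), 1; split=> //.
- by rewrite -[mpolyC _ _]mulr1 mul_mpolyC dhomogZ // dhomog1.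
- exact: dhomog1.
- by move=> q _; split; [case: (sval q) | rewrite rmorph1 divr1].
Qed.

Definition proj_cst_fun (c : K) : proj_sec oT := ProjSec (regular_cst c).

Let proj_cst_zmod : zmod_morphism proj_cst_fun.
Proof.
by move=> a b; apply: proj_sec_eq => p /=; rewrite mpolyCB rmorphB.
Qed.
Let proj_cst_monoid : monoid_morphism proj_cst_fun.
Proof.
split=> [|a b]; apply: proj_sec_eq => p /=; first by rewrite mpolyC1 rmorph1.
by rewrite mpolyCM rmorphM.
Qed.
HB.instance Definition _ := GRing.isZmodMorphism.Build K (proj_sec oT)
  proj_cst_fun proj_cst_zmod.
HB.instance Definition _ := GRing.isMonoidMorphism.Build K (proj_sec oT)
  proj_cst_fun proj_cst_monoid.

Definition proj_space : kspace K.
Proof.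
refine (@KSpace K proj proj_sec proj_res _ _ proj_sheaf proj_cst_fun).
- by move=> U h f; apply: proj_sec_eq => p /=; congr (f _); exact: point_eq.
- move=> U V W h h' h'' f; apply: proj_sec_eq => p /=.
  by congr (f _); exact: point_eq.
Defined.

Lemma Dplus_open (i : 'I_n.+1) : open [set p : proj | ~ pideal p (var i)].
Proof.
rewrite proj_openE; exists [set var i]; apply/seteqP; split=> p /= pi.
  by move=> /(_ _ erefl).
by move=> pi'; apply: pi => _ ->.
Qed.

Definition Dplus (i : 'I_n.+1) : opens proj_space := Opens _ (Dplus_open i).

Lemma regular_coord (i j : 'I_n.+1) :
  (fun _ => tofrac (var j) / tofrac (var i)) \in @regular_pred (Dplus i).
Proof.
apply/regularP => p ip; exists (Dplus i), 1%N, (var j), (var i); split=> //.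
- by rewrite dhomogX; apply/eqP; exact: mdeg1.
- by rewrite dhomogX; apply/eqP; exact: mdeg1.
Qed.

(* The quotient of coordinates [x_j / x_i]. *)
Definition xcoord (i j : 'I_n.+1) : osec (Dplus i) := ProjSec (regular_coord i j).

End ProjectiveSpace.

Section Varieties.
Variables (K : fieldType) (X : kspace K).

Definition projective_variety : Prop :=
  [/\ is_scheme X, is_integral X &
      exists (n : nat) (i : kmor X (proj_space K n)), closed_immersion i].

(* [phi] is the morphism given by the sections [s_0, ..., s_n] of the line
   bundle [L]: they have no common zero, the preimage of the chart [x_i <> 0]
   is the locus where [s_i] does not vanish, and [x_j / x_i] pulls back to
   [s_j / s_i] there. *)
Definition morphism_of_sections (L : omod X) (n : nat)
    (s : 'I_n.+1 -> gsec L) (phi : kmor X (proj_space K n)) : Prop :=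
  forall i : 'I_n.+1,
    (forall x : X, oset (Dplus K i) (phi x) <-> generates_at (s i) x) /\
    (forall j : 'I_n.+1,
       msharp phi (Dplus K i) (xcoord K i j)
         *: mres (sub_oT (opreim (mcont phi) (Dplus K i))) (s i : msec L oT)
       = mres (sub_oT (opreim (mcont phi) (Dplus K i))) (s j : msec L oT)).

(* The complete linear system of [L] embeds [X] as a closed subscheme of the
   projective space of [H^0(X, L)^*], in the coordinates given by a basis of
   [H^0(X, L)]. *)
Definition very_ample (L : omod X) : Prop :=
  exists (n : nat) (s : 'I_n.+1 -> gsec L) (phi : kmor X (proj_space K n)),
    [/\ is_basis s, morphism_of_sections s phi & closed_immersion phi].

(* Subsets of the projective space of a vector space [V^*] are represented by
   predicates on the nonzero elements of [V^*]. *)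

Section Cactus.
Variable L : omod X.
Implicit Types F G : dual (gsec L).

(* The projective linear subspace of the classes of the nonzero elements of
   [W] contains the closed subscheme [i : R -> X], as a subscheme: the linear
   forms that define it (the elements of [H^0(X, L)] that are killed by [W])
   restrict to zero on [R]. *)
Definition contains_subscheme (W : set (dual (gsec L))) (R : kspace K)
    (i : kmor R X) : Prop :=
  forall l : gsec L, (forall G, W G -> G l = 0) -> vanishes_on i l.

(* [F] represents a point of the linear span of [R]. *)
Definition in_span (R : kspace K) (i : kmor R X) F : Prop :=
  forall W : set (dual (gsec L)),
    subspace W -> contains_subscheme W i -> W F.

Definition cactus_rank_set F : set nat :=
  [set r | exists (R : kspace K) (i : kmor R X),
     [/\ is_scheme R, closed_immersion i, zero_dimensional R,
         (scheme_length R <= (r%:R)%:E)%E & in_span i F]].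

Definition cactus_rank F : \bar rat :=
  if F == 0 then 0%E else emin (cactus_rank_set F).

End Cactus.
End Varieties.

Section ZariskiClosure.
Variables (K : fieldType) (V : lmodType K).

(* Homogeneous polynomial functions on the dual of [V] whose coordinates are
   elements of [V]. *)
Definition homog_fun (g : dual V -> K) : Prop :=
  exists (n d : nat) (l : 'I_n -> V) (p : mpoly n K),
    p \is ishomog1 d mdeg /\ forall F, g F = meval (fun i => F (l i)) p.

Definition zariski_closed (Z : set (dual V)) : Prop :=
  exists S : set (dual V -> K), S `<=` homog_fun /\
    forall F, F <> 0 -> (Z F <-> forall g, S g -> g F = 0).

Definition zariski_closure (A : set (dual V)) : set (dual V) :=
  [set F | F <> 0 /\ forall Z : set (dual V), zariski_closed Z ->
     (forall G, G <> 0 -> A G -> Z G) -> Z F].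

End ZariskiClosure.

Arguments zariski_closure {K V} A.

Definition cactus_variety (K : fieldType) (X : kspace K) (L : omod X) (r : nat) :
  set (dual (gsec L)) :=
  zariski_closure [set F | (cactus_rank F <= (r%:R)%:E)%E].
Arguments cactus_variety {K X} L r.

(* Main.v *)
(* Let [R] be a zero-dimensional subscheme of length at most [r] whose span
   contains [F]. Since projective space is noetherian, [R] is discrete, so [E]
   is trivial on [R] and the sections of [E] that restrict to zero on [R] have
   codimension at most [r e] in [H^0(E)]. If [s] restricts to zero on [R], then
   so does [m(s, t)] for all [t]; these sections of [L] are killed by [F],
   because [F] is in the span of [R]. Hence [j(F)] factors through a quotient of
   dimension at most [r e] of [H^0(E)]. The minors are homogeneous polynomials
   in [F], so their vanishing passes to the Zariski closure. *)
Require Import Defs.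
From mathcomp Require Import all_boot all_order all_algebra.
From mathcomp Require Import boolp classical_sets constructive_ereal.
From mathcomp Require Import topology_structure.
From mathcomp Require Import -(notations) mpoly.
Set Implicit Arguments.
Unset Strict Implicit.
Unset Printing Implicit Defensive.
Import Order.TTheory GRing.Theory Num.Theory.
Local Open Scope classical_set_scope.
Local Open Scope ring_scope.

(** * Hilbert's basis theorem *)

(** Every tail of [u] attains its minimum; [phi] jumps repeatedly to a position of the minimum of
    the tail that remains. *)
Lemma nondecreasing_subseq (u : nat -> nat) : exists phi : nat -> nat,
  {homo phi : i j / (i < j)%N} /\ {homo u \o phi : i j / (i <= j)%N}.
Proof.
have /choice[g gP] : forall N, exists i, (N <= i)%N /\
    forall j, (N <= j)%N -> (u i <= u j)%N.
  move=> N; have ex : exists v, `[< exists2 i, (N <= i)%N & u i = v >].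
    by exists (u N); apply/asboolP; exists N.
  case: (ex_minnP ex) => v /asboolP[i Ni <-] vmin.
  by exists i; split=> // j Nj; apply: vmin; apply/asboolP; exists j.
pose phi := fix phi k := if k is k'.+1 then g (phi k').+1 else g 0%N.
have phi_incr : {homo phi : i j / (i < j)%N}.
  by apply: (homo_ltn ltn_trans) => k; have [] := gP (phi k).+1.
exists phi; split=> //.
apply: (homo_leq leqnn leq_trans) => -[|k] /=; first by apply: (gP 0%N).2.
by apply: (gP (phi k).+1).2; exact: (phi_incr k k.+2).
Qed.

(** This yields Dickson's lemma when [l] ranges over the variables and [u l] gives the exponents.
    The sequence is thinned out for one index at a time, since monotonicity survives in
    subsequences. *)
Lemma nondecreasing_subseqs (I : eqType) (u : I -> nat -> nat) (s : seq I) :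
  exists phi : nat -> nat, {homo phi : i j / (i < j)%N} /\
    forall l, l \in s -> {homo u l \o phi : i j / (i <= j)%N}.
Proof.
elim: s => [|l s [phi [phi_incr phiP]]]; first by exists id; split.
have [psi [psi_incr psiP]] := nondecreasing_subseq (u l \o phi).
exists (phi \o psi); split=> [i j ij|l']; first exact/phi_incr/psi_incr.
rewrite inE => /predU1P[->|l's] i j ij; first exact: psiP.
by apply: (phiP l' l's); exact: (ltnW_homo psi_incr) ij.
Qed.

Section HilbertBasis.
Variables (K : fieldType) (n : nat) (f : nat -> mpoly n K).

Let gen (k : nat) (p : mpoly n K) : Prop :=
  exists c : nat -> mpoly n K, p = \sum_(j < k) c j * f j.

Let gen0 k : gen k 0.
Proof. by exists (fun=> 0); rewrite big1 // => j _; rewrite mul0r. Qed.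

Let genMD k a p q : gen k p -> gen k q -> gen k (q + a * p).
Proof.
move=> [c ->] [d ->]; exists (fun j => d j + a * c j).
by rewrite mulr_sumr -big_split; apply: eq_bigr => j _; rewrite mulrDl mulrA.
Qed.

Let gen_le k k' p : (k <= k')%N -> gen k p -> gen k' p.
Proof.
move=> kk' [c ->]; exists (fun j => if (j < k)%N then c j else 0).
rewrite (big_ord_widen _ (fun j => c j * f j) kk') big_mkcond.
by apply: eq_bigr => j _; case: ifP => // _; rewrite mul0r.
Qed.

(** Holds because the monomial order is well-founded. *)
Let minimal_lead (P : mpoly n K -> Prop) p : P p ->
  exists2 q, P q & forall r, P r -> ~ (mlead r < mlead q)%O.
Proof.
move: p; suff H m : forall p, mlead p = m -> P p ->
    exists2 q, P q & forall r, P r -> ~ (mlead r < mlead q)%O.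
  by move=> p; exact: H.
elim/(well_founded_ind (@ltom_wf n)): m => m IH p pm Pp.
have [[r Pr rp]|nr] := pselect (exists2 r, P r & (mlead r < mlead p)%O).
  by apply: (IH _ _ r erefl Pr); rewrite -pm.
by exists p => // r Pr rp; apply: nr; exists r.
Qed.

(* Were there no such [k], pick for every [k] an element [h k] of the ideal of
   all the [f j] outside the ideal of the [f j] with [j < k], with a minimal
   leading monomial. By Dickson's lemma the leading monomial of some [h i]
   divides that of [h j] for some large [j], and cancelling leading terms
   contradicts the choice of [h j]. *)
Lemma hilbert_basis : exists (k : nat) (c : nat -> mpoly n K),
  f k = \sum_(j < k) c j * f j.
Proof.
apply: contrapT => nogen.
have /choice[h hP] : forall k, exists h, [/\ exists N, gen N h, ~ gen k h &
    forall r, (exists N, gen N r) -> ~ gen k r -> ~ (mlead r < mlead h)%O].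
  move=> k; have : (exists N, gen N (f k)) /\ ~ gen k (f k).
    split; last by move=> [c e]; apply: nogen; exists k, c.
    exists k.+1, (fun j => (j == k)%:R); rewrite big_ord_recr /= eqxx mul1r.
    by rewrite big1 ?add0r // => j _; rewrite ltn_eqF ?mul0r.
  move=> /(@minimal_lead (fun r => (exists N, gen N r) /\ ~ gen k r)).
  by move=> [q [? ?] qmin]; exists q; split=> // r ? ?; exact: qmin.
have [phi [phi_incr phiP]] :=
  nondecreasing_subseqs (fun l k => mlead (h k) l) (enum 'I_n).
have phi_ge k : (k <= phi k)%N.
  by elim: k => // k IH; apply: leq_ltn_trans IH _; exact: phi_incr.
pose i := phi 0%N; have [[N hiN] hi_nz _] := hP i.
(* [h i] is in the ideal of the first [N] polynomials, hence in that of the first [j], as [phi N] is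
   at least [N]. *)
pose j := phi N; have [[M hjM] hj_nz hj_min] := hP j.
have ij : lem (mlead (h i)) (mlead (h j)).
  by apply/mnm_lepP => l; apply: (phiP l); rewrite ?mem_enum.
have nz k : h k != 0 by apply/eqP => hk; have [_ + _] := hP k; rewrite hk.
pose d := mnm_sub (mlead (h j)) (mlead (h i)).
pose b :=
  (mcoeff (mlead (h j)) (h j) / mcoeff (mlead (h i)) (h i)) *: mpolyX K d.
have lcn k : mcoeff (mlead (h k)) (h k) != 0 by rewrite mleadc_eq0.
have bn : mcoeff (mlead (h j)) (h j) / mcoeff (mlead (h i)) (h i) != 0.
  by rewrite mulf_neq0 ?invr_neq0.
have b0 : b != 0.
  by rewrite -mleadc_eq0 mleadZ // mleadXm mcoeffZ mcoeffX eqxx mulr1.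
have lb : mlead (b * h i) = mlead (h j).
  by rewrite mleadM // mleadZ // mleadXm submK.
have cb : mcoeff (mlead (h j)) (b * h i) = mcoeff (mlead (h j)) (h j).
  by rewrite -scalerAl mcoeffZ -{2}(submK ij) [_ * h i]mulrC mcoeffMX divfK.
have q_out : ~ gen j (h j + (- b) * h i).
  move=> qj; apply: hj_nz; rewrite -[h j](addrK ((- b) * h i)) -mulNr opprK.
  by apply: genMD => //; apply: gen_le hiN; exact: phi_ge.
apply: (hj_min _ _ q_out).
  exists (maxn N M); apply: genMD; first exact: gen_le (leq_maxl _ _) hiN.
  exact: gen_le (leq_maxr _ _) hjM.
have le_q : (mlead (h j + (- b) * h i) <= mlead (h j))%O.
  by rewrite mulNr (le_trans (mleadB_le _ _)) // lb joinxx.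
(* If the leading monomial did not drop, its coefficient, which cancels, would be the leading
   coefficient of the difference. The difference would then be zero, hence in the ideal. *)
rewrite lt_neqAle le_q andbT; apply/eqP => eq_q.
have /eqP : mcoeff (mlead (h j)) (h j + (- b) * h i) = 0.
  by rewrite mulNr mcoeffB cb subrr.
rewrite -{1}eq_q mleadc_eq0 => /eqP q0; apply: q_out.
by rewrite q0; exact: gen0.
Qed.

End HilbertBasis.

(** * Discreteness of zero-dimensional subschemes *)

Lemma pideal_sum (K : fieldType) (n : nat) (p : proj K n) (k : nat)
    (c f : nat -> mpoly n.+1 K) :
  (forall j, (j < k)%N -> pideal p (f j)) -> pideal p (\sum_(j < k) c j * f j).
Proof.
case: p => P P0 PD PM ? ? ? ? /= Pf.
elim/big_ind: _ => // j _; apply: PM; exact: Pf.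
Qed.

Section NoetherianInduction.
Variables (K : fieldType) (n : nat) (R : kspace K) (j : R -> proj K n).
Hypothesis j_embed : forall U : set R, open U ->
  exists2 V, open V & U = j @^-1` V.

(** In a strict chain choose [x k] in [C k] outside [C k.+1], and [f k] vanishing on [C k.+1] but
    not at [x k]. Hilbert's theorem writes some [f k] through earlier ones, which all vanish at
    [x k]. *)
Lemma closed_chain_stationary (C : nat -> set R) :
  (forall k, closed (C k)) -> (forall k, C k.+1 `<=` C k) ->
  exists k, C k `<=` C k.+1.
Proof.
move=> C_closed C_dec; apply: contrapT => C_strict.
have C_le : forall i k, (i <= k)%N -> C k `<=` C i.
  move=> i k /subnK<-; elim: (k - i)%N => // m IH.
  by apply: subset_trans IH; exact: C_dec.
have /choice[A AE] : forall k, exists A : set (mpoly n.+1 K),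
    ~` C k = [set x | ~ (A `<=` pideal (j x))].
  move=> k; have /j_embed[V + ->] : open (~` C k) by exact: closed_openC.
  by rewrite proj_openE => -[A ->]; exists A.
have /choice[x xP] : forall k, exists x, C k x /\ ~ C k.+1 x.
  move=> k; apply: contrapT => nx; apply: C_strict; exists k => x Cx.
  by apply: contrapT => nCx; apply: nx; exists x.
have /choice[f fP] : forall k, exists f, A k.+1 f /\ ~ pideal (j (x k)) f.
  move=> k; have [_] := xP k; rewrite -[~ _]/((~` C k.+1) (x k)) AE /=.
  by move=> /existsNP[f /not_implyP]; exists f.
have [k [c fk]] := hilbert_basis f.
have [_] := fP k; apply; rewrite fk; apply: pideal_sum => i ik.
have Cx : C i.+1 (x k) by apply: (C_le _ _ ik); have [] := xP k.
apply: contrapT => nf; suff : (~` C i.+1) (x k) by exact.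
by rewrite AE /= => /(_ (f i)) Af; apply: nf; apply: Af; have [] := fP i.
Qed.

(** A counterexample would, by choice, start an infinite strictly descending chain of closed
    counterexamples. *)
Lemma noetherian_induction (P : set R -> Prop) :
  (forall Z, closed Z ->
     (forall Z', closed Z' -> Z' `<=` Z -> ~ (Z `<=` Z') -> P Z') -> P Z) ->
  forall Z, closed Z -> P Z.
Proof.
move=> ind Z0 Z0c; apply: contrapT => nPZ0.
have /choice[g gP] : forall Z, exists Z', closed Z -> ~ P Z ->
    [/\ closed Z', Z' `<=` Z, ~ (Z `<=` Z') & ~ P Z'].
  move=> Z; have [[Zc nPZ]|h] := pselect (closed Z /\ ~ P Z); last first.
    by exists Z => ? ?; exfalso; apply: h.
  apply: contrapT => nZ'; apply: nPZ; apply: ind => // Z' Z'c Z'Z ZZ'.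
  by apply: contrapT => nPZ'; apply: nZ'; exists Z'.
have CP k : closed (iter k g Z0) /\ ~ P (iter k g Z0).
  by elim: k => //= k [? ?]; have [] := gP (iter k g Z0).
have [|k|k] := @closed_chain_stationary (fun k => iter k g Z0).
- by move=> k; have [] := CP k.
- by have [? ?] := CP k; have [] := gP (iter k g Z0).
- by have [? ?] := CP k; have [] := gP (iter k g Z0).
Qed.

(* If irreducible closed sets are points, then all sets are closed: this holds
   for the subsets of an irreducible closed set, and is inherited by the union
   of two closed sets. *)
Lemma discrete_of_irreducible_points :
  (forall Z : set R, irreducible_closed Z -> exists x, Z = [set x]) ->
  forall U : set R, open U.
Proof.
move=> irr U; rewrite -[U]setCK; apply: closed_openC.
have H : forall Z : set R, closed Z -> forall Y, Y `<=` Z -> closed Y.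
  apply: noetherian_induction => Z Zc IH Y YZ.
  have [Z0|Zn] := pselect (Z = set0).
    by move: YZ; rewrite Z0 subset0 => ->; exact: closed0.
  have [Zirr|Zred] := pselect (irreducible_closed Z).
    have [x Zx] := irr Z Zirr; have [/eqP Y0|/set0P[y Yy]] := boolP (Y == set0).
      by rewrite Y0; exact: closed0.
    suff -> : Y = Z by [].
    apply/seteqP; split=> // z; move: (YZ _ Yy) (YZ).
    by rewrite Zx => yx _ ->; rewrite -yx.
  have [A [B [Ac Bc ZAB ZA ZB]]] : exists A B : set R, [/\ closed A, closed B,
      Z `<=` A `|` B, ~ (Z `<=` A) & ~ (Z `<=` B)].
    apply: contrapT => nAB; apply: Zred; split=> //.
      by apply/set0P/eqP.
    move=> A B Ac Bc ZAB; apply: contrapT => /not_orP[ZA ZB].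
    by apply: nAB; exists A, B.
  have YE : Y = (Y `&` A) `|` (Y `&` B).
    apply/seteqP; split=> [y Yy|y [[]|[]]//].
    by have [?|?] := ZAB y (YZ y Yy); [left | right].
  rewrite YE; apply: closedU.
    apply: (IH (Z `&` A)); [exact: closedI | by move=> ? [] | | exact: setSI].
    by move=> ZZA; apply: ZA => z /ZZA[].
  apply: (IH (Z `&` B)); [exact: closedI | by move=> ? [] | | exact: setSI].
  by move=> ZZB; apply: ZB => z /ZZB[].
exact: H closedT _ _.
Qed.

End NoetherianInduction.

(** Any neighbourhood of [y] contains its generization [x], so an inverse near [y] is also one near
    [x]. *)
Lemma unit_at_specialize (K : fieldType) (X : kspace K) (x y : X)
    (U : opens X) (f : osec U) :
  closure [set x] y -> unit_at y f -> unit_at x f.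
Proof.
move=> xy [V [h [g [Vy fg]]]]; exists V, h, g; split=> //.
have [z [/= -> //]] := xy _ (open_nbhs_nbhs (conj (openP V) Vy)).
Qed.

(** Points that specialize to each other have the same nonunit germs, hence give the same prime of
    an affine neighbourhood. *)
Lemma scheme_T0 (K : fieldType) (X : kspace K) (x y : X) : is_scheme X ->
  closure [set x] y -> closure [set y] x -> x = y.
Proof.
move=> [_ /(_ x)[U [Ux [Uprime Upt _ _]]]] xy yx.
have Uy : oset U y.
  by have [z [/= -> //]] := yx _ (open_nbhs_nbhs (conj (openP U) Ux)).
have [z [_ zU]] := Upt _ (Uprime x Ux).
rewrite -(zU x) // -(zU y) //; split=> //.
by apply/seteqP; split=> f /= nf uf; apply: nf; exact: unit_at_specialize uf.
Qed.

(** The closure of a point of [Z] is irreducible, so in dimension zero it is all of [Z]. Any two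
    points of [Z] thus specialize to each other. *)
Lemma zero_dimensional_irreducible (K : fieldType) (R : kspace K) :
  is_scheme R -> zero_dimensional R ->
  forall Z : set R, irreducible_closed Z -> exists x, Z = [set x].
Proof.
move=> Rsch Rdim Z Zirr; have [Zc [x Zx] _] := Zirr.
have clZ y : Z y -> closure [set y] = Z.
  move=> Zy; apply: Rdim => //; last first.
    by rewrite (closure_id Z).1 //; apply: closure_subset => _ ->.
  split; [exact: closed_closure | by exists y; exact: subset_closure|].
  move=> A B Ac Bc AB; have [Ay|By] := AB y (subset_closure erefl).
    by left; rewrite (closure_id A).1 //; apply: closure_subset => _ ->.
  by right; rewrite (closure_id B).1 //; apply: closure_subset => _ ->.
exists x; apply/seteqP; split=> [y Zy|_ -> //].
by apply/esym/(scheme_T0 Rsch); rewrite clZ.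
Qed.

Lemma closed_immersion_embed (K : fieldType) (X Y : kspace K) (i : kmor X Y) :
  closed_immersion i -> forall U : set X, open U ->
  exists2 V : set Y, open V & U = i @^-1` V.
Proof.
move=> [_ _ iE _] U Uo; have [V UV] := iE (Opens U Uo).
by exists V; [exact: openP | exact: UV].
Qed.

Lemma zero_dimensional_discrete (K : fieldType) (X R : kspace K) (n : nat)
    (phi : kmor X (proj_space K n)) (i : kmor R X) :
  closed_immersion phi -> closed_immersion i ->
  is_scheme R -> zero_dimensional R -> forall U : set R, open U.
Proof.
move=> phi_ci i_ci Rsch Rdim.
apply: (@discrete_of_irreducible_points K n R (phi \o i)).
  move=> U /(closed_immersion_embed i_ci)[V Vo ->].
  by have [W Wo ->] := closed_immersion_embed phi_ci Vo; exists W.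
exact: zero_dimensional_irreducible.
Qed.

(** * Linear algebra *)

Lemma linear_comb (R : pzRingType) (V W : lmodType R) (f : V -> W) :
  linear f -> forall (n : nat) (c : 'I_n -> R) (v : 'I_n -> V),
  f (\sum_(i < n) c i *: v i) = \sum_(i < n) c i *: f (v i).
Proof.
move=> f_lin n c v.
have f0 : f 0 = 0.
  by apply: (addrI (f 0)); have := f_lin 1 0 0; rewrite !scale1r !addr0.
by elim/big_rec2: _ => // i y z _ <-; rewrite f_lin.
Qed.

Lemma dual_comb (K : fieldType) (V : lmodType K) (n : nat) (c : 'I_n -> K)
    (u : 'I_n -> dual V) (v : V) :
  dapp (\sum_(i < n) c i *: u i) v = \sum_(i < n) c i * u i v.
Proof. by elim/big_rec2: _ => // i G y _ <-. Qed.

Lemma basis_coordinates (K : fieldType) (V : lmodType K) (n : nat)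
    (s : 'I_n -> V) : is_basis s ->
  exists2 c : V -> 'rV[K]_n, linear c & forall v, v = \sum_i c v 0 i *: s i.
Proof.
move=> [_ s_gen]; have /choice[c cP] : forall v, exists c : 'rV[K]_n,
    v = \sum_i c 0 i *: s i /\
    forall d : 'rV_n, v = \sum_i d 0 i *: s i -> d = c.
  move=> v; have [c [vE cU]] := s_gen v I; exists (\row_i c i); split.
    by rewrite {1}vE; apply: eq_bigr => i _; rewrite mxE.
  by move=> d /cU cd; apply/rowP => i; rewrite mxE cd.
exists c => [a u v|v]; last by have [] := cP v.
apply/esym/(cP _).2; rewrite {1}(cP u).1 {1}(cP v).1 scaler_sumr -big_split.
by apply: eq_bigr => i _; rewrite !mxE scalerDl scalerA.
Qed.

(** In coordinates, [W] is the row space of a matrix [M] of maximal rank among those with row space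
    inside [W]. Some column of [cokermx M] gives the functional. *)
Lemma separating_functional (K : fieldType) (V : lmodType K) (n : nat)
    (s : 'I_n -> V) (W : set V) (l : V) :
  is_basis s -> subspace W -> ~ W l ->
  exists2 G : dual V, forall v, W v -> G v = 0 & G l <> 0.
Proof.
move=> /basis_coordinates[c c_lin cE] [W0 Wlin] nWl.
pose comb (r : 'rV[K]_n) := \sum_i r 0 i *: s i.
have comb_lin a r q : comb (a *: r + q) = a *: comb r + comb q.
  rewrite /comb scaler_sumr -big_split; apply: eq_bigr => i _.
  by rewrite !mxE scalerDl scalerA.
pose P k := `[< exists2 M : 'M[K]_n,
  forall r : 'rV_n, (r <= M)%MS -> W (comb r) & \rank M = k >].
have P0 : exists k, P k.
  exists 0%N; apply/asboolP; exists 0; last exact: mxrank0.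
  move=> r /submx0null->; rewrite /comb big1 // => i _.
  by rewrite mxE scale0r.
have Pn k : P k -> (k <= n)%N by move=> /asboolP[M _ <-]; exact: rank_leq_row.
case: (ex_maxnP P0 Pn) => _ /asboolP[M MW <-] Mmax.
have WM v : W v -> (c v <= M)%MS.
  move=> Wv; have : P (\rank (M + c v)%MS).
    apply/asboolP; exists (M + c v)%MS => // _ /sub_addsmxP[[A B] ->] /=.
    rewrite [B]mx11_scalar mul_scalar_mx addrC comb_lin.
    apply: Wlin; first by rewrite /comb -cE.
    by apply: MW; exact: submxMl.
  move/Mmax => rk; apply: submx_trans (addsmxSr M (c v)) _.
  have := mxrank_leqif_sup (addsmxSl M (c v)); case=> + <-.
  by rewrite eqn_leq rk => ->.
have /rV0Pn[j Gl] : c l *m cokermx M != 0.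
  apply/eqP => /eqP; rewrite -submxE => lM; apply: nWl.
  by rewrite (cE l); exact: MW.
have G_scalar : scalar (fun v => (c v *m cokermx M) 0 j).
  by move=> a u v; rewrite c_lin mulmxDl -scalemxAl !mxE.
exists (mk_dual G_scalar); last exact/eqP.
by move=> v /WM; rewrite submxE /dapp /= => /eqP->; rewrite mxE.
Qed.

(** If evaluation from [V] to [K^b] were not onto, a nonzero functional killing its image would be a
    linear relation among the [u i]. *)
Lemma dual_basis (K : fieldType) (V : lmodType K) (b : nat)
    (u : 'I_b -> dual V) : is_basis u ->
  exists t : 'I_b -> V, forall i j, u i (t j) = (i == j)%:R.
Proof.
move=> [_ u_gen]; pose ev v := \row_k u k v.
pose W : set 'rV[K]_b := [set ev v | v in setT].
have W_sub : subspace W.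
  split; first by exists 0 => //; apply/rowP => k; rewrite !mxE /dapp linear0.
  move=> a _ _ [v _ <-] [w _ <-]; exists (a *: v + w) => //.
  by apply/rowP => k; rewrite !mxE /dapp linearP.
have delta_basis : is_basis (fun i => delta_mx 0 i : 'rV[K]_b).
  split=> // v _; exists (v 0); split; first exact: row_sum_delta.
  move=> d ->; apply: funext => i; rewrite summxE (bigD1 i) //= !mxE !eqxx.
  rewrite mulr1 big1 ?addr0 // => j ji.
  by rewrite !mxE eq_sym (negbTE ji) mulr0.
suff /choice[t tP] : forall j, exists v, ev v = delta_mx 0 j.
  by exists t => i j; have /rowP/(_ i) := tP j; rewrite !mxE eqxx.
move=> j; apply: contrapT => nj.
have nW : ~ W (delta_mx 0 j) by move=> [v _ vj]; apply: nj; exists v.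
have [G GW Gj] := separating_functional delta_basis W_sub nW.
have u0 : 0 = \sum_k G (delta_mx 0 k) *: u k.
  suff H v : dapp (\sum_k G (delta_mx 0 k) *: u k) v = 0.
    by apply: dual_ext => v; exact/esym/H.
  rewrite dual_comb -[RHS](GW (ev v) (ex_intro2 _ _ v I erefl)).
  rewrite (row_sum_delta (ev v)) /dapp linear_sum; apply: eq_bigr => k _.
  by rewrite linearZ mulrC mxE.
have [c [_ cU]] := u_gen 0 I.
have c0 : 0 = \sum_k (0 : K) *: u k by rewrite big1 // => k _; rewrite scale0r.
by apply: Gj; have /(congr1 (@^~ j)) := cU _ u0; rewrite (cU _ c0) => <-.
Qed.

(** If the [f (v i)] are independent, so are the rows [g (v i)], because the kernel of [g] lies in
    that of [f]. Hence such families have at most [m] members, and a largest one gives a basis of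
    the range. *)
Lemma range_basis (K : fieldType) (V W : lmodType K) (m : nat) (f : V -> W)
    (g : V -> 'rV[K]_m) :
  linear f -> linear g -> (forall v, g v = 0 -> f v = 0) ->
  exists (n : nat) (b : 'I_n -> W), (n <= m)%N /\ Defs.basis_of (range f) b.
Proof.
move=> f_lin g_lin gf.
pose indep n (v : 'I_n -> V) := forall c : 'I_n -> K,
  \sum_i c i *: f (v i) = 0 -> forall i, c i = 0.
pose P n := `[< exists v : 'I_n -> V, indep n v >].
have P0 : exists n, P n.
  by exists 0%N; apply/asboolP; exists (fun=> 0) => c _ [].
have Pm n : P n -> (n <= m)%N.
  move=> /asboolP[v v_ind]; pose M := \matrix_i g (v i).
  suff /eqP<- : row_free M by exact: rank_leq_col.
  apply: inj_row_free => c cM; apply/rowP => i; rewrite mxE.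
  apply: (v_ind (c 0)); rewrite -(linear_comb f_lin); apply: gf.
  rewrite (linear_comb g_lin); apply: etrans cM; rewrite mulmx_sum_row.
  by apply: eq_bigr => k _; rewrite rowK.
case: (ex_maxnP P0 Pm) => n /asboolP[v v_ind] n_max.
exists n, (f \o v); split; first by apply: Pm; apply/asboolP; exists v.
split=> [i|_ [x _ <-]]; first by exists (v i).
suff [c xE] : exists c : 'I_n -> K, f x = \sum_i c i *: f (v i).
  exists c; split=> // d dE; apply: funext => i; apply/eqP; rewrite -subr_eq0.
  apply/eqP; apply: (v_ind (fun i => c i - d i)); rewrite -[RHS](subrr (f x)).
  rewrite {1}xE dE -sumrB; apply: eq_bigr => k _; exact: scalerBl.
(* Putting [x] in front of [v] breaks independence by maximality; in the resulting relation the
   coefficient at [x] is nonzero. *)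
pose w (i : 'I_n.+1) := oapp v x (unlift ord0 i).
have /existsNP[c /not_implyP[c0 /existsNP[k ck]]] : ~ indep n.+1 w.
  move=> w_ind; suff /n_max : P n.+1 by rewrite ltnn.
  by apply/asboolP; exists w.
have {}c0 : c ord0 *: f x + \sum_i c (lift ord0 i) *: f (v i) = 0.
  rewrite -[RHS]c0 big_ord_recl /w unlift_none; congr (_ + _).
  by apply: eq_bigr => i _; rewrite liftK.
have ck0 : c ord0 != 0.
  apply/eqP => c00; apply: ck; rewrite c00 scale0r add0r in c0.
  have cl := v_ind _ c0; case: (unliftP ord0 k) => [i ->|-> //].
  exact: cl.
exists (fun i => - (c ord0)^-1 * c (lift ord0 i)).
apply: (scalerI ck0); move/eqP: c0; rewrite addr_eq0 => /eqP->.
rewrite scaler_sumr -sumrN; apply: eq_bigr => i _.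
by rewrite scalerA mulNr mulrN mulVKf // scaleNr.
Qed.

(** * Restriction to a discrete subscheme *)

Lemma mres_comb (K : fieldType) (X : kspace K) (M : omod X) (U V : opens X)
    (h : V `<=` U) (n : nat) (c : 'I_n -> osec U) (m : 'I_n -> msec M U) :
  mres h (\sum_(k < n) c k *: m k) = \sum_(k < n) ores h (c k) *: mres h (m k).
Proof.
by elim/big_rec2: _ => [|k s t _ <-]; [exact: mres0 | exact: mresP].
Qed.

Section Vanishing.
Variables (K : fieldType) (X R : kspace K) (i : kmor R X).

(** This is the uniqueness of gluing for the empty cover. *)
Lemma osec_empty (U : opens X) (f g : osec U) : oset U = set0 -> f = g.
Proof.
move=> U0; have [||t [_ tU]] := @osheaf K X void U (fun v => match v with end)
    (fun v => match v with end) _ (fun v => match v with end).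
- by rewrite U0; exact: sub0set.
- by case.
- by transitivity t; [apply/esym|]; apply: tU; case.
Qed.

(** Morphisms are linear over functions, so coefficients in the ideal sheaf are kept. *)
Lemma vanishes_on_hom (M N : omod X) (g : hom_on M N oT) (s : gsec M) :
  vanishes_on i s -> vanishes_on i (g oT (sub_oT oT) s : gsec N).
Proof.
move=> sR x; have [U [n [f [m [Ux fR sE]]]]] := sR x.
exists U, n, f, (fun k => g U (sub_oT U) (m k)); split=> //.
rewrite (hfun_res _ _ _ (sub_oT U)) sE.
exact: (@linear_comb _ (msec M U) (msec N U) _ (hfunP g (sub_oT U))).
Qed.

Lemma vanishes_on_subspace (M : omod X) :
  subspace [set s : gsec M | vanishes_on i s].
Proof.
split=> [x|a s t sR tR x].
  exists oT, 0%N, (fun=> 0), (fun=> 0); split=> [//|[]//|].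
  by rewrite big_ord0 mres0.
have [U [n [f [m [Ux fR sE]]]]] := sR x.
have [V [p [h [l [Vx hR tE]]]]] := tR x.
pose W := ocap U V; have WU : W `<=` U by move=> ? [].
have WV : W `<=` V by move=> ? [].
(* The two combinations are concatenated on the overlap, with [a] absorbed into the coefficients of
   the first. *)
exists W, (n + p)%N,
  (fun k : 'I_(n + p) => match fintype.split k with
     inl k => ores (sub_oT W) (kstr X a) * ores WU (f k)
   | inr k => ores WV (h k)
   end),
  (fun k : 'I_(n + p) => match fintype.split k with
     inl k => mres WU (m k)
   | inr k => mres WV (l k)
   end).
split=> [//|k|].
  have WU' : opreim (mcont i) W `<=` opreim (mcont i) U by move=> ? [].
  have WV' : opreim (mcont i) W `<=` opreim (mcont i) V by move=> ? [].
  case: fintype.split => k'; last by rewrite -(msharp_res WV WV') hR rmorph0.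
  by rewrite rmorphM -(msharp_res WU WU') fR rmorph0 mulr0.
have -> : mres (sub_oT W) (a *: s + t : msec M oT) =
    ores (sub_oT W) (kstr X a) *: mres WU (mres (sub_oT U) (s : msec M oT)) +
    mres WV (mres (sub_oT V) (t : msec M oT)).
  by rewrite !(mres_comp _ _ (sub_oT W)); exact: mresP.
rewrite sE tE !mres_comb big_split_ord scaler_sumr; congr (_ + _).
  by apply: eq_bigr => k _; rewrite (unsplitK (inl _ k)) scalerA.
by apply: eq_bigr => k _; rewrite (unsplitK (inr _ k)).
Qed.
End Vanishing.

Lemma is_frame_res (K : fieldType) (X : kspace K) (M : omod X) (U V : opens X)
    (h : V `<=` U) (n : nat) (b : 'I_n -> msec M U) :
  is_frame b -> is_frame (fun k => mres h (b k)).
Proof.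
move=> b_frame W k s; have [c [sE cU]] := b_frame W (subset_trans k h) s.
have bE l : mres k (mres h (b l)) = mres (subset_trans k h) (b l).
  exact: mres_comp.
exists c; split; first by under eq_bigr do rewrite bE.
by move=> d dE; apply: cU; rewrite dE; under eq_bigr do rewrite bE.
Qed.

Lemma frame_coordinates (K : fieldType) (X : kspace K) (M : omod X)
    (U : opens X) (n : nat) (b : 'I_n -> msec M U) : is_frame b ->
  exists c : msec M U -> 'I_n -> osec U,
    (forall s, s = \sum_k c s k *: b k) /\
    (forall a s t k, c (a *: s + t) k = a * c s k + c t k).
Proof.
move=> b_frame; have /choice[c cP] : forall s, exists c : 'I_n -> osec U,
    s = \sum_k c k *: b k /\ forall d, s = \sum_k d k *: b k -> c = d.
  move=> s; have [c [sE cU]] := b_frame U (@subset_refl _ U) s.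
  exists c; split; first by rewrite {1}sE; under eq_bigr do rewrite mres_id.
  by move=> d dE; apply: cU; under eq_bigr do rewrite mres_id.
exists c; split=> [s|a s t k]; first by have [] := cP s.
suff /(cP _).2-> : a *: s + t = \sum_k (a * c s k + c t k) *: b k by [].
rewrite {1}(cP s).1 {1}(cP t).1 scaler_sumr -big_split.
by apply: eq_bigr => l _; rewrite scalerDl scalerA.
Qed.

Section Discrete.
Variables (K : fieldType) (X R : kspace K) (i : kmor R X).
Hypothesis i_ci : closed_immersion i.
Hypothesis R_discrete : forall U : set R, open U.

(** As the point [x] is open in [R], a trivializing neighbourhood of [i x] can be shrunk until it
    meets [R] in [x] only. *)
Lemma locally_free_frame_at (e : nat) (E : omod X) (x : R) : locally_free e E ->
  exists (V : opens X) (b : 'I_e -> msec E V),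
    is_frame b /\ oset (opreim (mcont i) V) = [set x].
Proof.
move=> /(_ (i x))[U [b [Ux b_frame]]].
have [V Vo xV] := closed_immersion_embed i_ci (R_discrete [set x]).
have h : ocap U (Opens V Vo) `<=` U by move=> ? [].
exists (ocap U (Opens V Vo)), (fun k => mres h (b k)).
split; first exact: is_frame_res.
rewrite xV; apply/seteqP; split=> [y []//|y /= Vy]; split=> //.
suff -> : y = x by [].
by have : (i @^-1` V) y by []; rewrite -xV.
Qed.

(** The one-point sets cover [R], and distinct ones are disjoint, so compatibility is automatic. *)
Lemma glue_points (W : R -> opens R) (s : forall x, osec (W x)) :
  (forall x, oset (W x) = [set x]) ->
  exists! t : osec oT, forall x, ores (sub_oT (W x)) t = s x.
Proof.
move=> Wx; apply: osheaf => [x _|x y V hx hy].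
  by exists x => //; rewrite Wx.
have [xy|xy] := pselect (x = y).
  by subst y; congr (ores _ _); exact: Prop_irrelevance.
apply: osec_empty; apply/seteqP; split=> // z Vz; apply: xy.
by have := hx z Vz; have := hy z Vz; rewrite !Wx => -> .
Qed.

(* A vector bundle is trivial on a discrete subscheme [R]: the coefficients of
   a section in local frames at the points of [R] glue to [e] functions on [R],
   and [g] lists the coordinates of these functions in the basis [b]. *)
Lemma discrete_restriction (e N : nat) (E : omod X)
    (b : 'I_N -> gsec (omod_struct R)) :
  locally_free e E -> is_basis b ->
  exists2 g : gsec E -> 'rV[K]_(e * N), linear g &
    forall s, g s = 0 -> vanishes_on i s.
Proof.
move=> E_free /basis_coordinates[p p_lin pE].
have /choice[fr frP] : forall x, exists Vb : {V : opens X & 'I_e -> msec E V},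
    is_frame (projT2 Vb) /\ oset (opreim (mcont i) (projT1 Vb)) = [set x].
  move=> x; have [V [bV bP]] := locally_free_frame_at x E_free.
  by exists (existT _ V bV).
pose V x := projT1 (fr x); pose W x := opreim (mcont i) (V x).
have c_ex x := frame_coordinates (frP x).1.
pose c x := sval (cid (c_ex x)) : msec E (V x) -> 'I_e -> osec (V x).
have cE x : forall s, s = \sum_k c x s k *: projT2 (fr x) k.
  exact: (svalP (cid (c_ex x))).1.
have c_lin x : forall a s t k, c x (a *: s + t) k = a * c x s k + c x t k.
  exact: (svalP (cid (c_ex x))).2.
(* The pullback to the point [x] of the [k]-th coordinate of [s] in the frame chosen there. *)
pose germ (s : gsec E) k x : osec (W x) :=
  msharp i (V x) (c x (mres (sub_oT (V x)) (s : msec E oT)) k).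
have glue s k := @glue_points W (germ s k) (fun x => (frP x).2).
pose f (s : gsec E) (k : 'I_e) : gsec (omod_struct R) := sval (cid (glue s k)).
have fE s k x : ores (sub_oT (W x)) (f s k : osec oT) = germ s k x.
  exact: (svalP (cid (glue s k))).1.
have f_lin a s t k : f (a *: s + t) k = a *: f s k + f t k.
  suff H : forall x, ores (sub_oT (W x))
      (kstr R a * (f s k : osec oT) + (f t k : osec oT)) =
      germ (a *: s + t) k x.
    exact: (svalP (cid (glue (a *: s + t) k))).2.
  move=> x; rewrite rmorphD rmorphM /= !fE /germ.
  have -> : mres (sub_oT (V x)) (a *: s + t : msec E oT) =
      ores (sub_oT (V x)) (kstr X a) *: mres (sub_oT (V x)) (s : msec E oT) +
      mres (sub_oT (V x)) (t : msec E oT) by exact: mresP.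
  rewrite c_lin rmorphD rmorphM; congr (_ * _ + _).
  have h : opreim (mcont i) (V x) `<=` opreim (mcont i) oT by [].
  rewrite -(msharp_res (sub_oT (V x)) h) msharp_kstr.
  by rewrite (ores_comp _ _ (sub_oT (W x))).
exists (fun s => mxvec (\matrix_(k < e) p (f s k))).
  move=> a s t; rewrite -linearP; congr mxvec; apply/row_matrixP => k.
  by rewrite linearP /= !rowK f_lin p_lin.
move=> s /(canRL (@mxvecK _ _ _)); rewrite linear0 => p0.
have f0 k : f s k = 0.
  rewrite (pE (f s k)) big1 // => l _.
  by have /matrixP/(_ k l) := p0; rewrite !mxE => ->; rewrite scale0r.
have [_ i_closed _ _] := i_ci.
move=> y; have [[x _ <-]|ny] := pselect (range i y).
  exists (V x), e, (c x (mres (sub_oT (V x)) (s : msec E oT))), (projT2 (fr x)).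
  split=> [|k|//]; first by have := (frP x).2 => /seteqP[_]; apply.
  by have := fE s k x; rewrite f0 rmorph0 /germ => <-.
(* Off the closed image of [R], the coefficient 1 pulls back to a section over the empty set, which
   is zero. *)
exists (Opens _ (closed_openC i_closed)), 1%N, (fun=> 1),
  (fun=> mres (sub_oT _) (s : msec E oT)).
split=> //; last by rewrite big_ord1 scale1r.
move=> _; apply: osec_empty; apply/seteqP; split=> // x /= nx.
by apply: nx; exists x.
Qed.
End Discrete.

(** * Cactus rank *)

Lemma emin_le (P : set nat) (r : nat) :
  (emin P <= (r%:R)%:E)%E -> exists2 m, P m & (m <= r)%N.
Proof.
rewrite /emin; case: pselect => [h|_]; last by rewrite leye_eq.
case: (ex_minnP h) => m /asboolP Pm _; rewrite lee_fin ler_nat => mr.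
by exists m.
Qed.

Lemma emin_ge (P : set nat) (m : nat) : P m -> (emin P <= (m%:R)%:E)%E.
Proof.
move=> Pm; rewrite /emin; case: pselect => [h|[]].
  by rewrite lee_fin ler_nat; case: (ex_minnP h) => k _; apply; apply/asboolP.
by exists m; apply/asboolP.
Qed.

Lemma emin_nat (P : set nat) :
  emin P = +oo%E \/ exists r : nat, emin P = (r%:R)%:E.
Proof.
by rewrite /emin; case: pselect => [h|_]; [right; exists (ex_minn h) | left].
Qed.

Section CactusRank.
Variables (K : fieldType) (X : kspace K) (L : omod X).

(** The functionals killing all sections that vanish on [R] form a subspace [W]. It contains [R],
    because in the finite-dimensional space of sections a subspace is its own double annihilator;
    hence [F] is in [W]. *)
Lemma in_span_vanishes (R : kspace K) (i : kmor R X) (F : dual (gsec L))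
    (l : gsec L) :
  very_ample L -> in_span i F -> vanishes_on i l -> F l = 0.
Proof.
move=> [n [s [phi [s_basis _ _]]]] F_span l0.
pose W : set (dual (gsec L)) := [set G | forall l, vanishes_on i l -> G l = 0].
apply: (F_span W) => //.
  split=> [l' _|a G H GW HW l' l'0]; first by [].
  rewrite -[LHS]/(a * dapp G l' + dapp H l').
  by rewrite [dapp G l']GW // [dapp H l']HW // mulr0 addr0.
move=> l' l'W; apply: contrapT => nl'.
have [G GW] := separating_functional s_basis (vanishes_on_subspace i L) nl'.
by apply; exact: l'W.
Qed.

Variables (E : omod X) (T : tensor L (omod_dual E)).

Lemma jmap_linear (F : dual (gsec L)) : linear (jmap T F).
Proof.
move=> a s s'; apply: dual_ext => t.
by rewrite /jmap /= mulmapDl /dapp linearP.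
Qed.

Lemma jmap_rank_le (e r : nat) (F : dual (gsec L)) :
  projective_variety X -> very_ample L -> locally_free e E ->
  (cactus_rank F <= (r%:R)%:E)%E ->
  exists (n : nat) (b : 'I_n -> dual (gsec T)),
    (n <= r * e)%N /\ Defs.basis_of (range (jmap T F)) b.
Proof.
move=> [_ _ [N [phi phi_ci]]] L_va E_free; rewrite /cactus_rank.
case: eqP => [-> _|_ /emin_le[m [R [i [Rsch i_ci Rdim]]]]].
  (* The zero functional has cactus rank 0 by convention, so no [R] is given; instead [j(0) = 0]
     factors through [K^0]. *)
  have g_lin : linear (fun _ : gsec E => 0 : 'rV[K]_0).
    by move=> a u v; rewrite scaler0 addr0.
  have [v _|n [b [n0 bP]]] := range_basis (jmap_linear 0) g_lin.
    exact: dual_ext.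
  by exists n, b; split=> //; apply: leq_trans n0 _.
move=> /emin_le[k [c c_basis] km] F_span mr.
have R_disc := zero_dimensional_discrete phi_ci i_ci Rsch Rdim.
have [g g_lin g0] := discrete_restriction i_ci R_disc E_free c_basis.
have [|n [b [nek bP]]] := range_basis (jmap_linear F) g_lin.
  move=> s /g0 s0; apply: dual_ext => t.
  (* The product of [s] and [t] is the image of [s] under the morphism from [E] to [L] given by [t],
     so it vanishes on [R]. *)
  apply: (in_span_vanishes L_va F_span).
  exact: (vanishes_on_hom (ev T oT (sub_oT oT) t) s0).
exists n, b; split=> //; apply: leq_trans nek _.
by rewrite mulnC leq_mul2r (leq_trans km mr) orbT.
Qed.

End CactusRank.

(** * Minors and the cactus variety *)

Lemma dhomog_prod1 (K : fieldType) (n : nat) (I : Type) (s : seq I)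
    (F : I -> mpoly n K) :
  (forall i, F i \is ishomog1 1 mdeg) ->
  \prod_(i <- s) F i \is ishomog1 (size s) mdeg.
Proof.
move=> F1; elim: s => [|i s IH]; first by rewrite big_nil; exact: dhomog1.
by rewrite big_cons -[size _]/(1 + size s)%N; exact: dhomogM.
Qed.

(** The polynomial is the generic determinant, with variables numbered by [mxvec_index]; each
    Leibniz product has degree [k]. *)
Lemma homog_det (K : fieldType) (V : lmodType K) (k : nat) (A : 'M[V]_k) :
  homog_fun (fun F : dual V => \det (\matrix_(i, j) F (A i j))).
Proof.
pose B := \matrix_(i < k, j < k) (mpolyX K (mnm1 (mxvec_index i j))).
have prodB (s : 'I_k -> 'I_k) : \prod_i B i (s i) \is ishomog1 k mdeg.
  rewrite -[X in ishomog1 X](size_enum_ord k) -big_enum.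
  by apply: dhomog_prod1 => i; rewrite mxE dhomogX; apply/eqP; exact: mdeg1.
exists (k * k)%N, k, (fun x => mxvec A 0 x), (\det B); split.
  by apply: rpred_sum => s _; rewrite rpredMsign; exact: prodB.
move=> F; rewrite -det_map_mx; congr (\det _); apply/matrixP => i j.
by rewrite !mxE /= mevalXU mxvecE.
Qed.

(** The [k] rows are combinations of the [n] rows [b l (w j)]. As [n < k], the rows of coefficients
    are dependent, and so are the rows of the matrix. *)
Lemma det_range_basis (K : fieldType) (V W : lmodType K) (f : V -> dual W)
    (n k : nat) (b : 'I_n -> dual W) (v : 'I_k -> V) (w : 'I_k -> W) :
  Defs.basis_of (range f) b -> (n < k)%N ->
  \det (\matrix_(i, j) f (v i) (w j)) = 0.
Proof.
move=> [_ b_gen] nk.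
have /choice[d dE] : forall i, exists d : 'I_n -> K,
    f (v i) = \sum_l d l *: b l.
  by move=> i; have [|d []] := b_gen (f (v i)); [exists (v i) | exists d].
pose D := \matrix_(i, l) d i l.
have /rowV0Pn[c /sub_kermxP cD c0] : kermx D != 0.
  by rewrite kermx_eq0 /row_free neq_ltn (leq_ltn_trans (rank_leq_col D)).
apply/eqP/det0P; exists c => //; apply/rowP => j; rewrite !mxE.
transitivity (\sum_l (c *m D) 0 l * b l (w j)); last first.
  by rewrite cD big1 // => l _; rewrite mxE mul0r.
under [RHS]eq_bigr do rewrite mxE mulr_suml.
rewrite exchange_big; apply: eq_bigr => i _.
rewrite mxE dE dual_comb mulr_sumr; apply: eq_bigr => l _.
by rewrite mxE mulrA.
Qed.

Theorem theorem4 (K : closedFieldType) (X : kspace K) (L E : omod X) (e : nat)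
    (T : tensor L (omod_dual E)) :
  projective_variety X -> line_bundle L -> very_ample L ->
  (1 <= e)%N -> locally_free e E ->
  (forall F : dual (gsec L), (jrank T F * ((e%:R)^-1)%:E <= cactus_rank F)%E) /\
  (forall (a b : nat) (s : 'I_a -> gsec E) (u : 'I_b -> dual (gsec T)),
     is_basis s -> is_basis u ->
     exists A : 'M[gsec L]_(a, b),
       (forall (F : dual (gsec L)) (i : 'I_a),
          jmap T F (s i) = \sum_(k < b) F (A i k) *: u k) /\
       (forall (r : nat) (f : 'I_(r * e).+1 -> 'I_a) (g : 'I_(r * e).+1 -> 'I_b),
          {homo f : i j / (i < j)%N} -> {homo g : i j / (i < j)%N} ->
          forall F : dual (gsec L), cactus_variety L r F ->
            \det (\matrix_(i, j) F (A (f i) (g j))) = 0)).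
Proof.
move=> X_proj _ L_va e_gt0 E_free; split=> [F|a b s u _ u_basis].
  have [Foo|[r Fr]] : cactus_rank F = +oo%E \/
      exists r : nat, cactus_rank F = (r%:R)%:E.
  - rewrite /cactus_rank; case: eqP => _; last exact: emin_nat.
    by right; exists 0%N.
  - by rewrite Foo leey.
  have Fle : (cactus_rank F <= (r%:R)%:E)%E by rewrite Fr.
  have [n [b [nre b_basis]]] := jmap_rank_le T X_proj L_va E_free Fle.
  rewrite Fr lee_pdivrMr ?ltr0n // -EFinM -natrM.
  apply: (@le_trans _ _ (n%:R)%:E); last by rewrite lee_fin ler_nat.
  by apply: emin_ge; exists b.
(* The family [t] dual to [u] reads off coordinates: the coefficient of [j(F)(s i)] at [u k] is its
   value at [t k], namely [F] of the product of [s i] and [t k]. *)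
have [t tE] := dual_basis u_basis.
pose A := \matrix_(i, k) mulmap (s i) (t k).
exists A; split=> [F i|r f g _ _ F [_ F_closure]].
  have [d [jE _]] := u_basis.2 (jmap T F (s i)) I.
  rewrite jE; apply: eq_bigr => k _; congr (_ *: _).
  transitivity (jmap T F (s i) (t k)); last by rewrite mxE.
  rewrite jE dual_comb (bigD1 k) //= tE eqxx mulr1 big1 ?addr0 // => l lk.
  by rewrite tE (negbTE lk) mulr0.
pose minor (G : dual (gsec L)) : K := \det (\matrix_(i, j) G (A (f i) (g j))).
(* The zero locus of the minor is Zariski closed, so it suffices to treat functionals of cactus rank
   at most [r]. *)
apply: (F_closure [set G | minor G = 0]).
  exists [set minor]; split.
    move=> _ ->; have [N [d [l [p [p_homog pE]]]]] :=
      homog_det (\matrix_(i, j) A (f i) (g j)).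
    exists N, d, l, p; split=> // G; rewrite -pE; congr (\det _).
    by apply/matrixP => i j; rewrite !mxE.
  by move=> G _; split=> [GZ _ ->|]; [exact: GZ | apply].
move=> G _ Gr.
have [n [c [nre c_basis]]] := jmap_rank_le T X_proj L_va E_free Gr.
(* The bound [n <= r * e] is exactly [n < (r * e).+1], the order of the minor. *)
rewrite /= -[RHS](det_range_basis (s \o f) (t \o g) c_basis nre).
by congr (\det _); apply/matrixP => i j; rewrite !mxE.
Qed.
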